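(* Let $q,r\in\mathbb{R}$ be constants, let $\pi(\eta,\beta)$ be an improper prior on $(0,\infty)^2$ such that $$\pi(\eta,\beta)\propto \eta^{r}\beta^{q},$$ and suppose that the posterior related to $\pi(\eta,\beta)$, based on complete or right-censored Weibull data $(x_i,\delta_i)_{i=1}^n$, is proper. Then the posterior moments relative to $\beta$ are finite and the posterior moments relative to $\eta$ are not finite; that is, for every $k>0$, $E[\beta^k\mid\boldsymbol{x}]<\infty$ and $E[\eta^k\mid\boldsymbol{x}]=\infty$.
   Context: Model: the Weibull distribution with parameters $\eta>0$, $\beta>0$ has density $f(x\mid\eta,\beta)=\beta\eta^{\beta}x^{\beta-1}e^{-\eta^\beta x^\beta}$ for $x>0$. The data are $n\ge 1$ pairs $(x_i,\delta_i)$, where $x_i>0$ is the observed time (the minimum of the lifetime and an independent censoring time whose distribution does not depend on the parameters) and $\delta_i\in\{0,1\}$ equals $1$ if the $i$th observation is non-censored and $0$ if it is right-censored (complete data means all $\delta_i=1$). Put $m=\sum_{i=1}^n\delta_i$. For a (measurable, positive, possibly non-integrable) prior $\pi(\eta,\beta)$ on $(0,\infty)^2$, the posterior density is $$\pi(\eta,\beta\mid\boldsymbol{x})=\frac{\pi(\eta,\beta)}{d(\boldsymbol{x})}\,\eta^{m\beta}\beta^{m}\left(\prod_{i=1}^n x_i^{\delta_i\beta}\right)\exp\left\{-\sum_{i=1}^n x_i^\beta\eta^\beta\right\},$$ $$d(\boldsymbol{x})=\int_0^\infty\int_0^\infty \pi(\eta,\beta)\,\eta^{m\beta}\beta^{m}\left(\prod_{i=1}^n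 x_i^{\delta_i\beta}\right)\exp\left\{-\sum_{i=1}^n x_i^\beta\eta^\beta\right\}d\eta\,d\beta .$$ The prior is improper if its integral over $(0,\infty)^2$ is infinite. The posterior is called proper if $d(\boldsymbol{x})<\infty$ and improper if $d(\boldsymbol{x})=\infty$. When it is proper, the posterior moments relative to $\beta$ (resp. $\eta$) are the expectations $E[\beta^k\mid\boldsymbol{x}]$ (resp. $E[\eta^k\mid\boldsymbol{x}]$), $k>0$, with respect to the posterior density. The notation $g\propto h$ means that there are constants $c_0,c_1>0$ with $c_0h\le g\le c_1h$ on the whole common domain. *)

(* Defs.v *)
From HB Require Import structures.
From mathcomp Require Import all_boot all_order all_algebra.
From mathcomp Require Import all_classical all_reals all_analysis.

Set Implicit Arguments.
Unset Strict Implicit.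
Unset Printing Implicit Defensive.

Import Order.TTheory GRing.Theory Num.Theory.
Import numFieldNormedType.Exports.

Local Open Scope classical_set_scope.
Local Open Scope ring_scope.

(* A point of the parameter space is a pair (eta, beta). *)
Definition param_space (R : realType) : set (R * R) :=
  `]0, +oo[ `*` `]0, +oo[.

Definition param_integral (R : realType) (f : R * R -> R) : \bar R :=
  (\int[lebesgue_measure \x lebesgue_measure]_(p in @param_space R) (f p)%:E)%E.

(* The prior is an arbitrary positive measurable function; it need not be
   integrable. *)
Definition is_prior (R : realType) (prior : R * R -> R) : Prop :=
  measurable_fun (@param_space R) prior /\
  forall p, param_space p -> 0 < prior p.

Definition improper_prior (R : realType) (prior : R * R -> R) : Prop :=
  is_prior prior /\ param_integral prior = +oo%E.

(* g \propto h is not exact proportionality, but two-sided comparability up to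
   positive constants. *)
Definition propto (R : realType) (T : Type) (D : set T) (g h : T -> R) : Prop :=
  exists c0 c1 : R, [/\ 0 < c0, 0 < c1 &
    forall p, D p -> c0 * h p <= g p <= c1 * h p].

(* The observed times are x_i; delta_i is true iff x_i is not censored. *)
Definition weibull_likelihood (R : realType) (n : nat) (x : 'I_n -> R)
    (delta : 'I_n -> bool) (p : R * R) : R :=
  let: (eta, beta) := p in
  let m := (\sum_(i < n) delta i)%N in
  eta `^ (m%:R * beta) * beta ^+ m
  * (\prod_(i < n) x i `^ ((delta i)%:R * beta))
  * expR (- \sum_(i < n) x i `^ beta * eta `^ beta).

(* The normalizing constant d(x). *)
Definition marginal (R : realType) (prior : R * R -> R) (n : nat)
    (x : 'I_n -> R) (delta : 'I_n -> bool) : \bar R :=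
  param_integral (fun p => prior p * weibull_likelihood x delta p).

Definition proper_posterior (R : realType) (prior : R * R -> R) (n : nat)
    (x : 'I_n -> R) (delta : 'I_n -> bool) : Prop :=
  (marginal prior x delta < +oo)%E.

(* Meaningful only for a proper posterior, since fine +oo = 0. *)
Definition posterior_density (R : realType) (prior : R * R -> R) (n : nat)
    (x : 'I_n -> R) (delta : 'I_n -> bool) (p : R * R) : R :=
  prior p / fine (marginal prior x delta) * weibull_likelihood x delta p.

Definition posterior_expectation (R : realType) (prior : R * R -> R) (n : nat)
    (x : 'I_n -> R) (delta : 'I_n -> bool) (f : R * R -> R) : \bar R :=
  param_integral (fun p => f p * posterior_density prior x delta p).

(* Main.v *)
Require Import Defs.
From HB Require Import structures.
From mathcomp Require Import all_boot all_order all_algebra.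
From mathcomp Require Import ring lra.
From mathcomp Require Import all_classical all_reals all_analysis.
From mathcomp Require Import measurable_realfun.

Set Implicit Arguments.
Unset Strict Implicit.
Unset Printing Implicit Defensive.

Import Order.TTheory GRing.Theory Num.Theory.
Import numFieldNormedType.Exports.

Local Open Scope classical_set_scope.
Local Open Scope ring_scope.

(** Up to the two constants of comparability, the unnormalized posterior
    density at (eta, beta) is the exponential of
<<
  (r + m beta) a + Q ln beta + p beta - sum_i exp (beta (l_i + a))
>>
    where a = ln eta, l_i = ln x_i, p is the sum of the l_i over the
    non-censored observations and Q = q + m. Multiplying by a power of eta, or
    of beta, shifts r, or Q. So both assertions are about the finiteness of the
    integral I(r, Q) of this kernel.

    - If r > -1, then I(r, Q) is infinite whatever Q is
      ([kernel_integral_pinfty_gt]): as beta tends to 0, the damping factor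
      exp (- sum_i (x_i eta)^beta) only acts beyond eta ~ exp (1 / beta), and
      the mass of eta^r up to that point is exponential in 1 / beta, which
      beats every power of beta.
    - If r < -1, then I(r, Q) is infinite ([kernel_integral_pinfty_lt]):
      for small beta, eta^(r + m beta) is not integrable at eta = 0.
    - If r = -1 and m > 0, the integral in eta is of the order of
      beta^(Q - 1) for small beta, and of beta^(Q - 1) exp ((p - m L) beta) for
      large beta, where L is the largest l_i; here p <= m L. When p < m L, the
      exponential decay absorbs any power of beta, so that large values of beta
      never matter ([kernel_le_cauchy]). When p = m L, which includes the case
      m = 0, the integral is infinite: because of the small values of beta if
      Q <= 0 ([kernel_integral_pinfty_le0]), and because of the large ones if
      Q > 0 ([kernel_integral_pinfty_tied]).

    Hence a proper posterior forces r = -1 and p < m L. The moment of order k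
    of beta amounts to I(-1, Q + k), which is then finite because beta^k <= 1
    for beta <= 1 and because of the exponential decay for beta >= 1
    ([finite_kernel_integral_beta]). The moment of order k of eta
    amounts to I(k - 1, Q), and k - 1 > -1, so it is infinite. The latter
    conclusion also needs the normalizing constant to be positive
    ([kernel_integral_gt0]).

    No integral is computed. Divergence comes from boxes on which the kernel is
    bounded below by a constant: either single boxes giving arbitrarily large
    contributions ([param_integral_pinfty]), or, in the only logarithmically
    divergent case, disjoint boxes whose contributions dominate the harmonic
    series ([param_integral_pinfty_harmonic]). Convergence comes from the
    integrability of a product of two Cauchy densities. *)

(** * Bounds on the exponent of the posterior kernel *)

Section Exponent.
Context {R : realType}.
Implicit Types (a b e s t K : R).

(** The tangent line inequality ln y <= y - 1 at y = e x / s; this is how powers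
    are compared with exponentials throughout. *)
Lemma ln_mul_le_linear s e : 0 <= s -> 0 < e ->
  exists C : R, forall x : R, 0 < x -> s * ln x <= e * x + C.
Proof.
rewrite le_eqVlt => /predU1P[<- e0|s0 e0].
  by exists 0 => x x0; rewrite mul0r addr0 mulr_ge0// ltW.
have c0 : 0 < e / s by rewrite divr_gt0.
exists (- (s * ln (e / s))) => x x0.
have : ln (e / s * x) <= e / s * x - 1.
  rewrite -[X in ln X](addrNK 1) addrC le_ln1Dx//.
  by rewrite ltrBrDr addNr mulr_gt0.
rewrite lnM ?posrE// => h.
have {h}: s * (ln (e / s) + ln x) <= s * (e / s * x - 1) by rewrite ler_pM2l.
rewrite !mulrDr mulrA (mulrCA s) mulfV ?gt_eqF// mulr1 => h.
lra.
Qed.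

Lemma powR_expR_ln (a s : R) : 0 < a -> a `^ s = expR (s * ln a).
Proof. by move=> a0; rewrite /powR gt_eqF. Qed.

(** This bounds the eta-length of an interval of length [h] in ln eta; it comes
    from exp (- h) <= 1 / (1 + h). *)
Lemma expR_interval_ge t h : 0 < h <= 1 ->
  expR t * h / 2 <= expR t - expR (t - h).
Proof.
move=> /andP[h0 h1].
rewrite expRD -[X in _ <= X - _]mulr1 -mulrBr -mulrA ler_wpM2l ?expR_ge0//.
have : expR (- h) * (1 + h) <= 1.
  rewrite -[leRHS](expRxMexpNx_1 h) mulrC ler_wpM2r ?expR_ge0//.
  exact: expR_ge1Dx.
have := expR_gt0 (- h); nra.
Qed.

Lemma half_interval_ln (Q : R) (v b : R) : 0 < v -> v / 2 < b <= v ->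
  Q * ln v - `|Q| * ln 2 <= Q * ln b.
Proof.
move=> v0 /andP[h1 h2]; have b0 : 0 < b by apply: lt_trans h1; rewrite divr_gt0.
have : `|Q * (ln b - ln v)| <= `|Q| * ln 2.
  rewrite normrM ler_wpM2l// ler_norml lerBlDr lerBrDr addrC -ln_div ?posrE//.
  rewrite ler_ln ?posrE ?divr_gt0// (ltW h1)/=.
  rewrite (@le_trans _ _ (ln v)) ?ler_ln ?posrE//.
  by rewrite lerDr ln_ge0// ler1n.
by rewrite ler_norml => /andP[+ _]; rewrite mulrBr; lra.
Qed.

Variables (n : nat) (l : 'I_n -> R) (m p : R).

(** The logarithm of the density, in the coordinates a = ln eta and b = beta:
    products of powers become sums that can be estimated term by term. *)
Definition log_kernel r Q a b : R :=
  (r + m * b) * a + Q * ln b + p * b - \sum_(i < n) expR (b * (l i + a)).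

Hypothesis m_ge0 : 0 <= m.

(** For b <= 1 and b a <= 1 each eta^b is bounded, so the exponential damping
    and the factor exp (p b) are harmless, uniformly in [r] and [Q]. *)
Lemma log_kernel_ge : exists C : R, forall r Q a b, 0 < b <= 1 -> b * a <= 1 ->
  (r + m * b) * a + Q * ln b - C <= log_kernel r Q a b.
Proof.
exists (`|p| + \sum_(i < n) expR (`|l i| + 1)) => r Q a b /andP[b0 b1] ba.
have hp : - `|p| <= p * b.
  have : `|p * b| <= `|p| by rewrite normrM ler_piMr// gtr0_norm.
  by rewrite ler_norml => /andP[].
have hs : \sum_(i < n) expR (b * (l i + a)) <= \sum_(i < n) expR (`|l i| + 1).
  apply: ler_sum => i _; rewrite ler_expR mulrDr lerD//.
  by rewrite (le_trans (ler_norm _))// normrM ler_piMl// gtr0_norm.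
rewrite /log_kernel; lra.
Qed.

(** The hypothesis p = m L says that the non-censored observations are all tied
    at the largest time. Then exp (p b) eta^(m b) = exp (m b (L + a)), which is
    bounded below as soon as b (L + a) is, however large b may be. *)
Lemma log_kernel_ge_tied L Q a b : (forall i, l i <= L) -> p = m * L ->
  0 < b -> - 2 <= b * (L + a) <= 0 ->
  - a - 2 * m + Q * ln b - n%:R <= log_kernel (-1) Q a b.
Proof.
move=> lL pE b0 /andP[h1 h2].
have hs : \sum_(i < n) expR (b * (l i + a)) <= n%:R.
  rewrite -[n in n%:R]card_ord -sumr_const; apply: ler_sum => i _.
  by rewrite expR_le1 (le_trans _ h2)// ler_pM2l// lerD2r.
have : m * (-2) <= m * (b * (L + a)) by rewrite ler_wpM2l.
rewrite /log_kernel pE; lra.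
Qed.

(** With w = exp (b (L + a)), the kernel is at most
    exp (- a) (w^m exp (- w)) b^Q exp ((p - m L) b). For b >= 1, the factor
    w^m exp (- w) decays at least like exp (- |L + a|) on both sides of
    a = - L, thanks to 1 <= m on the left; together with exp (- a) this gives
    min (1, eta^(-2)), up to a constant. *)
Lemma log_kernel_le L : 1 <= m -> (exists j, l j = L) -> p < m * L ->
  forall Q, exists C : R, forall a b, 1 <= b ->
  log_kernel (-1) Q a b <= C - Num.max 0 (2 * a) - 2 * ln b.
Proof.
move=> m1 [j lj] pL Q; set g := m * L - p.
have g0 : 0 < g by rewrite subr_gt0.
have Q0 : 0 <= `|Q| + 2 by rewrite addr_ge0.
have M0 : 0 <= m + 1 by rewrite addr_ge0.
have [C1 HC1] := ln_mul_le_linear Q0 g0.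
have [C2 HC2] := ln_mul_le_linear M0 ltr01.
exists (C1 + `|C2| + 3 * `|L|) => a b b1.
have b0 : 0 < b by apply: lt_le_trans b1.
have hQ : (Q + 2) * ln b <= g * b + C1.
  apply: le_trans (HC1 _ b0); rewrite ler_wpM2r ?ln_ge0// lerD2r.
  exact: ler_norm.
have hs : expR (b * (L + a)) <= \sum_(i < n) expR (b * (l i + a)).
  by rewrite (bigD1 j)//= lj lerDl sumr_ge0// => i _; rewrite expR_ge0.
have hL : - `|L| <= L <= `|L| by rewrite -ler_norml.
have hC2 : C2 <= `|C2| by exact: ler_norm.
have hC20 : 0 <= `|C2| by exact: normr_ge0.
suff : - a + m * (b * (L + a)) - expR (b * (L + a)) <=
    `|C2| + 3 * `|L| - Num.max 0 (2 * a).
  rewrite /log_kernel; move: hQ; rewrite /g; lra.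
(* On the left w <= 1, so that w^m <= w <= exp (L + a); on the right
   w^(m + 1) <= C exp w, so that w^m exp (- w) <= C / w. *)
have [z0|z0] := leP (L + a) 0.
  have e0 := expR_ge0 (b * (L + a)).
  have : m * (b * (L + a)) <= L + a.
    have : 1 <= m * b by nra.
    nra.
  case: (leP 0 (2 * a)); lra.
have e0 := expR_gt0 (b * (L + a)).
have := HC2 _ e0; rewrite expRK mul1r.
have : L + a <= b * (L + a) by nra.
case: (leP 0 (2 * a)); lra.
Qed.

End Exponent.

(** * Integrals over the parameter space *)

Section Integration.
Context {R : realType}.
Local Notation D := (@param_space R).
Local Notation mu := (@lebesgue_measure R \x @lebesgue_measure R)%E.

Lemma measurable_param_space : measurable D.
Proof. by apply: measurableX; exact: measurable_itv. Qed.

Lemma param_spaceP (z : R * R) : D z -> 0 < z.1 /\ 0 < z.2.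
Proof. by case=> /=; rewrite !in_itv/= !andbT. Qed.

Lemma param_integral_le (f g : R * R -> R) :
  measurable_fun D f -> measurable_fun D g ->
  (forall z, D z -> 0 <= f z <= g z) ->
  (param_integral f <= param_integral g)%E.
Proof.
move=> mf mg fg; apply: ge0_le_integral.
- exact: measurable_param_space.
- by move=> z /fg /andP[f0 _]; rewrite lee_fin.
- exact/measurable_EFinP.
- exact/measurable_EFinP.
- by move=> z /fg /andP[_ f0]; rewrite lee_fin.
Qed.

Lemma param_integralZ (c : R) (f : R * R -> R) : 0 <= c ->
  measurable_fun D f -> (forall z, D z -> 0 <= f z) ->
  param_integral (fun z => c * f z) = (c%:E * param_integral f)%E.
Proof.
move=> c0 mf f0; rewrite /param_integral -ge0_integralZl//.
- exact: measurable_param_space.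
- exact/measurable_EFinP.
Qed.

Lemma param_integralD (f g : R * R -> R) :
  measurable_fun D f -> (forall z, D z -> 0 <= f z) ->
  measurable_fun D g -> (forall z, D z -> 0 <= g z) ->
  param_integral (fun z => f z + g z) = (param_integral f + param_integral g)%E.
Proof.
move=> mf f0 mg g0; rewrite /param_integral -ge0_integralD//.
- exact: measurable_param_space.
- exact/measurable_EFinP.
- exact/measurable_EFinP.
Qed.

(** Boxes are half-open so that consecutive ones are disjoint, and logarithmic
    in eta because the kernel is. *)
Definition log_box (a h v w : R) : set (R * R) :=
  `]expR (a - h), expR a] `*` `]v, w].

Lemma measurable_log_box a h v w : measurable (log_box a h v w).
Proof. by apply: measurableX; exact: measurable_itv. Qed.

Lemma log_box_sub a h v w : 0 <= v -> log_box a h v w `<=` D.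
Proof.
move=> v0 [x y] [/=]; rewrite !in_itv/= => /andP[h1 _] /andP[h2 _].
split; rewrite /= in_itv/= andbT.
- exact: lt_trans (expR_gt0 _) h1.
- exact: le_lt_trans h2.
Qed.

Lemma expR_box_le_integral (f : R * R -> R) (K a h v w : R) :
  measurable_fun D f -> 0 < h <= 1 -> 0 <= v < w ->
  (forall t b : R, a - h < t <= a -> v < b <= w -> expR K <= f (expR t, b)) ->
  ((expR (K + a) * h * (w - v) / 2)%:E <=
     \int[mu]_(z in log_box a h v w) (f z)%:E)%E.
Proof.
move=> mf h01 /andP[v0 vw] Kf.
have lea : expR (a - h) < expR a.
  by rewrite ltr_expR ltrBlDr ltrDl; case/andP: h01.
have Kf' z : log_box a h v w z -> expR K <= f z.
  case: z => x y [/=]; rewrite !in_itv/= => /andP[h1 h2] hy.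
  have x0 : 0 < x by apply: lt_trans h1; exact: expR_gt0.
  rewrite -[x]lnK ?posrE//; apply: Kf => //.
  by rewrite -ltr_expR -ler_expR lnK ?posrE// h1 h2.
apply: (@le_trans _ _ (\int[mu]_(z in log_box a h v w) cst (expR K)%:E z)%E).
  rewrite integral_cst; last exact: measurable_log_box.
  rewrite [X in (_ * X)%E](_ : _ = (@lebesgue_measure R `]expR (a - h), expR a]
      * @lebesgue_measure R `]v, w])%E); last first.
    by apply: product_measure1E; exact: measurable_itv.
  rewrite !lebesgue_measure_itv/= !lte_fin lea vw -!EFinB -!EFinM lee_fin.
  rewrite expRD -!mulrA ler_wpM2l ?expR_ge0//.
  rewrite (_ : _ * _ = (expR a * h / 2) * (w - v)); last by ring.
  by rewrite ler_wpM2r ?subr_ge0 ?(ltW vw)// expR_interval_ge.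
apply: ge0_le_integral.
- exact: measurable_log_box.
- by move=> z _; rewrite lee_fin expR_ge0.
- exact: measurable_cst.
- apply/measurable_EFinP; apply: measurable_funS mf.
    exact: measurable_param_space.
  exact: log_box_sub.
- by move=> z /Kf'; rewrite lee_fin.
Qed.

Lemma integral_log_box_le (f : R * R -> R) (a h v w : R) :
  measurable_fun D f -> (forall z, D z -> 0 <= f z) -> 0 <= v ->
  (\int[mu]_(z in log_box a h v w) (f z)%:E <= param_integral f)%E.
Proof.
move=> mf f0 v0; apply: ge0_subset_integral.
- exact: measurable_log_box.
- exact: measurable_param_space.
- exact/measurable_EFinP.
- by move=> z /f0; rewrite lee_fin.
- exact: log_box_sub.
Qed.

Lemma ereal_unbounded (x : \bar R) :
  (forall A : R, (A%:E <= x)%E) -> x = +oo%E.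
Proof.
case: x => [x|//|] h; last by have := h 0.
by have := h (x + 1); rewrite lee_fin gerDl ler10.
Qed.

(** The contribution of a box must absorb its size, hence the factor exp a: the
    eta-length of the box is about h exp a. *)
Lemma param_integral_pinfty (f : R * R -> R) :
  measurable_fun D f -> (forall z, D z -> 0 <= f z) ->
  (forall A : R, exists K a h v w, [/\ 0 < h <= 1, 0 <= v < w,
     A <= expR (K + a) * h * (w - v) &
     forall t b : R, a - h < t <= a -> v < b <= w ->
       expR K <= f (expR t, b)]) ->
  param_integral f = +oo%E.
Proof.
move=> mf f0 H; apply: ereal_unbounded => A.
have [K [a [h [v [w [h1 vw hA hf]]]]]] := H (2 * A).
have v0 : 0 <= v by case/andP: vw.
apply: le_trans (integral_log_box_le a h w mf f0 v0).
apply: le_trans (expR_box_le_integral mf h1 vw hf).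
by rewrite lee_fin ler_pdivlMr// mulrC.
Qed.

(** The i-th box has eta in ]exp (- i - 1), exp (- i)], whence disjointness;
    its area is about exp (- i) / (i + 1), so that it contributes a constant
    multiple of 1 / (i + 1). *)
Lemma param_integral_pinfty_harmonic (f : R * R -> R) K :
  measurable_fun D f -> (forall z, D z -> 0 <= f z) ->
  (forall (i : nat) (t b : R),
     - i%:R - 1 < t <= - i%:R -> 0 < b <= i.+1%:R^-1 ->
     expR (K + i%:R) <= f (expR t, b)) ->
  param_integral f = +oo%E.
Proof.
move=> mf f0 H.
pose B (i : nat) := log_box (- i%:R) 1 0 i.+1%:R^-1.
have tB : trivIset setT B.
  apply/trivIsetP => i j _ _.
  wlog ij : i j / (i < j)%N => [hw|_].
    rewrite neq_ltn => /orP[ij|ji]; first by apply: hw => //; rewrite ltn_eqF.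
    by rewrite setIC; apply: hw => //; rewrite ltn_eqF.
  rewrite -subset0 => -[x y] [[/= + _] [/= + _]].
  rewrite !in_itv/= => /andP[h1 _] /andP[_ h2].
  have := lt_le_trans h1 h2; rewrite ltr_expR.
  have : (i.+1%:R : R) <= j%:R by rewrite ler_nat.
  rewrite -natr1; lra.
have hN N : ((expR K / 2 * series harmonic N)%:E <= param_integral f)%E.
  apply: (@le_trans _ _ (\sum_(i <- iota 0 N) \int[mu]_(z in B i) (f z)%:E)%E).
    rewrite /series/= mulr_sumr -sumEFin /index_iota subn0.
    apply: lee_sum => i _.
    have := @expR_box_le_integral f (K + i%:R) (- i%:R) 1 0 i.+1%:R^-1 mf.
    rewrite ltr01 lexx lexx invr_gt0 ltr0n /= => /(_ isT isT (H i)).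
    by apply: le_trans; rewrite lee_fin addrK subr0 mulr1 mulrAC.
  have sD : \big[setU/set0]_(i <- iota 0 N) B i `<=` D.
    apply: (big_ind (fun A => A `<=` D)) => //.
      by move=> A1 A2 h1 h2; rewrite subUset.
    by move=> i _; exact: log_box_sub.
  have mU : measurable (\big[setU/set0]_(i <- iota 0 N) B i).
    by apply: bigsetU_measurable => i _; exact: measurable_log_box.
  rewrite -ge0_integral_bigsetU//.
  - apply: ge0_subset_integral => //.
    + exact: measurable_param_space.
    + exact/measurable_EFinP.
  - by move=> i; exact: measurable_log_box.
  - exact: iota_uniq.
  - exact: sub_trivIset tB.
  - apply/measurable_EFinP; apply: measurable_funS mf => //.
    exact: measurable_param_space.
  - by move=> z /sD /f0; rewrite lee_fin.
apply: contrapT => /eqP fy; apply: (@dvg_harmonic R).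
have ffin : param_integral f \is a fin_num.
  rewrite ge0_fin_numE ?ltey//; apply: integral_ge0 => z /f0.
  by rewrite lee_fin.
apply: nondecreasing_is_cvgn.
  apply/nondecreasing_seqP => N; rewrite seriesSr lerDl.
  exact: harmonic_ge0.
exists (fine (param_integral f) / (expR K / 2)) => _ [N _ <-].
by rewrite ler_pdivlMr ?divr_gt0 ?expR_gt0// mulrC -lee_fin fineK.
Qed.

Lemma integral_oneDsqrV :
  (\int[@lebesgue_measure R]_x ((oneDsqr x)^-1)%:E < +oo)%E.
Proof.
rewrite (@ge0_symfun_integralT _ (fun x : R => (oneDsqr x)^-1)).
- rewrite (_ : [set x : R | 0 <= x] = `[0, +oo[%classic); last first.
    by apply/seteqP; split => x /=; rewrite in_itv/= andbT.
  by rewrite integral0y_oneDsqr -EFinM ltry.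
- by move=> x; rewrite invr_ge0 addr_ge0// sqr_ge0.
- exact: continuous_oneDsqrV.
- by move=> x /=; rewrite /oneDsqr sqrrN.
Qed.

Definition cauchy_weight (z : R * R) : R := (oneDsqr z.1)^-1 * (oneDsqr z.2)^-1.

Lemma measurable_cauchy_weight : measurable_fun setT cauchy_weight.
Proof.
have mo : measurable_fun setT (fun x : R => (oneDsqr x)^-1).
  by apply: continuous_measurable_fun; exact: continuous_oneDsqrV.
apply: measurable_funM.
- exact: (measurableT_comp mo measurable_fst).
- exact: (measurableT_comp mo measurable_snd).
Qed.

Lemma cauchy_weight_ge0 z : 0 <= cauchy_weight z.
Proof. by rewrite mulr_ge0// invr_ge0 addr_ge0// sqr_ge0. Qed.

Lemma cauchy_weight_integral : (param_integral cauchy_weight < +oo)%E.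
Proof.
have mo : measurable_fun setT (fun x : R => (oneDsqr x)^-1).
  by apply: continuous_measurable_fun; exact: continuous_oneDsqrV.
have og (x : R) : 0 <= (oneDsqr x)^-1 by rewrite invr_ge0 addr_ge0// sqr_ge0.
apply: (@le_lt_trans _ _ (\int[mu]_z (cauchy_weight z)%:E)%E).
  apply: ge0_subset_integral => //.
  - exact: measurable_param_space.
  - by apply/measurable_EFinP; exact: measurable_funS measurable_cauchy_weight.
  - by move=> z _; rewrite lee_fin cauchy_weight_ge0.
rewrite fubini_tonelli1; last 2 first.
- by apply/measurable_EFinP; exact: measurable_cauchy_weight.
- by move=> z; rewrite lee_fin cauchy_weight_ge0.
have [c c0 cE] : exists2 c : R, 0 <= c &
    (\int[@lebesgue_measure R]_x ((oneDsqr x)^-1)%:E = c%:E)%E.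
  have i0 : (0 <= \int[@lebesgue_measure R]_x ((oneDsqr x)^-1)%:E)%E.
    by apply: integral_ge0 => x _; rewrite lee_fin.
  exists (fine (\int[@lebesgue_measure R]_x ((oneDsqr x)^-1)%:E)%E).
    exact: fine_ge0.
  by rewrite fineK// ge0_fin_numE// integral_oneDsqrV.
rewrite [ltLHS](_ : _ =
    \int[@lebesgue_measure R]_x (c%:E * ((oneDsqr x)^-1)%:E))%E; last first.
  apply: eq_integral => x _; rewrite /fubini_F/= muleC -cE -ge0_integralZl//.
  exact/measurable_EFinP.
rewrite ge0_integralZl//.
- by rewrite cE -EFinM ltry.
- exact/measurable_EFinP.
Qed.

End Integration.

(** * Finiteness of the integral of the posterior kernel *)

Section Kernel.
Context {R : realType}.
Local Notation D := (@param_space R).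
Variables (n : nat) (l : 'I_n -> R) (m p : R).

(** The posterior density for the prior eta^r beta^(Q - m), without its
    normalizing constant. *)
Definition posterior_kernel r Q (z : R * R) : R :=
  expR (log_kernel l m p r Q (ln z.1) z.2).

Lemma kernel_ge0 r Q z : 0 <= posterior_kernel r Q z.
Proof. exact: expR_ge0. Qed.

Lemma kernel_mul_eta (r Q k : R) (z : R * R) : D z ->
  z.1 `^ k * posterior_kernel r Q z = posterior_kernel (r + k) Q z.
Proof.
move=> /param_spaceP[u0 b0]; rewrite powR_expR_ln// /posterior_kernel -expRD.
by congr expR; rewrite /log_kernel; ring.
Qed.

Lemma kernel_mul_beta (r Q k : R) (z : R * R) : D z ->
  z.2 `^ k * posterior_kernel r Q z = posterior_kernel r (Q + k) z.
Proof.
move=> /param_spaceP[u0 b0]; rewrite powR_expR_ln// /posterior_kernel -expRD.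
by congr expR; rewrite /log_kernel; ring.
Qed.

Lemma measurable_posterior_kernel r Q : measurable_fun D (posterior_kernel r Q).
Proof.
apply: (@measurable_funS _ _ _ _ setT) => //.
have m1 : measurable_fun setT (fun z : R * R => ln z.1).
  exact: (measurableT_comp (@measurable_ln R) measurable_fst).
have m2 : measurable_fun setT (fun z : R * R => z.2) := measurable_snd.
have m3 : measurable_fun setT (fun z : R * R => ln z.2).
  exact: (measurableT_comp (@measurable_ln R) measurable_snd).
apply: (measurableT_comp (@measurable_expR R)).
apply: measurable_funB; last first.
  apply: measurable_sum => i; apply: (measurableT_comp (@measurable_expR R)).
  by apply: measurable_funM => //; apply: measurable_funD.
apply: measurable_funD; last by apply: measurable_funM.
apply: measurable_funD; last by apply: measurable_funM.
apply: measurable_funM => //; apply: measurable_funD => //.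
exact: measurable_funM.
Qed.

Hypothesis m_ge0 : 0 <= m.

(** Any box on which the kernel has a positive lower bound would do; here
    eta in ]exp (-1), 1] and beta in ]1/2, 1]. *)
Lemma kernel_integral_gt0 (r Q : R) :
  (0 < param_integral (posterior_kernel r Q))%E.
Proof.
have [C HC] := log_kernel_ge l m p.
have m0 : 0 <= m := m_ge0.
pose K : R := - (`|r| + m) - `|Q| * ln 2 - C.
apply: (@lt_le_trans _ _ (expR (K + 0) * 1 * (1 - 2^-1) / 2)%:E).
  rewrite lte_fin divr_gt0// mulr_gt0 ?mulr_gt0 ?expR_gt0//; lra.
have h1 : (0 < 1 :> R) && (1 <= 1 :> R) by rewrite ltr01 /=.
have h2 : (0 <= 2^-1 :> R) && (2^-1 < 1 :> R) by lra.
have mk := measurable_posterior_kernel r Q.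
apply: (le_trans (expR_box_le_integral mk h1 h2 _)).
  move=> t b ht hb; rewrite /posterior_kernel expRK ler_expR.
  have hb1 : 0 < b <= 1 by lra.
  have b0 : 0 < b by lra.
  apply: le_trans (HC r Q t b hb1 _); last by nra.
  rewrite /K lerD2r lerD//.
    have : `|(r + m * b) * t| <= `|r| + m.
      have t1 : `|t| <= 1 by rewrite ler_norml; lra.
      have rm : `|r + m * b| <= `|r| + m.
        rewrite (le_trans (ler_normD _ _))// lerD2l.
        rewrite normrM (ger0_norm m_ge0) gtr0_norm// ler_piMr//; lra.
      by rewrite normrM (le_trans _ rm)// ler_piMr.
    by rewrite ler_norml => /andP[].
  have : `|Q * ln b| <= `|Q| * ln 2.
    rewrite normrM ler_wpM2l// ler_norml.
    rewrite -lnV ?posrE// ler_ln ?posrE//.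
    apply/andP; split; first by lra.
    by rewrite (le_trans (ln_le0 _)) ?ln_ge0//; lra.
  by rewrite ler_norml => /andP[].
apply: integral_log_box_le => //.
by move=> z _; exact: kernel_ge0.
Qed.

(** With s = 1 / beta large, the box eta in ]exp (s - 1), exp s], beta in
    ]1 / 2s, 1 / s] keeps eta^beta bounded; it contributes about
    exp ((r + 1) s), up to a power of s. *)
Lemma kernel_integral_pinfty_gt (r Q : R) : -1 < r ->
  param_integral (posterior_kernel r Q) = +oo%E.
Proof.
move=> r1; apply: param_integral_pinfty.
- exact: measurable_posterior_kernel.
- by move=> z _; exact: kernel_ge0.
move=> A.
have [C HC] := log_kernel_ge l m p.
have m0 : 0 <= m := m_ge0.
have e0 : 0 < (r + 1) / 2 by lra.
have Q0 : 0 <= `|Q| + 1 by rewrite addr_ge0.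
have [C2 HC2] := ln_mul_le_linear Q0 e0.
pose C3 : R := `|r| + `|Q| * ln 2 + C + C2.
pose s : R := Num.max 1 ((2 * A + C3) / ((r + 1) / 2)).
have s1 : 1 <= s by rewrite /s le_max lexx.
have s0 : 0 < s by apply: lt_le_trans s1.
have sA : 2 * A + C3 <= (r + 1) / 2 * s.
  by rewrite [leRHS]mulrC -ler_pdivrMr// /s le_max lexx orbT.
pose K : R := r * s - `|r| - `|Q| * ln s - `|Q| * ln 2 - C.
have v0 : 0 < s^-1 by rewrite invr_gt0.
exists K, s, 1, (s^-1 / 2), s^-1; split.
- by rewrite ltr01 /=.
- by lra.
- have -> : expR (K + s) * 1 * (s^-1 - s^-1 / 2) = expR (K + s - ln s) / 2.
    rewrite [in RHS]expRB lnK ?posrE//; lra.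
  rewrite ler_pdivlMr//; apply: le_trans (expR_ge1Dx _).
  have := HC2 s s0; rewrite /K; move: sA; rewrite /C3; lra.
- move=> t b /andP[t1 t2] hb; rewrite /posterior_kernel expRK ler_expR.
  have b1 : 0 < b <= 1.
    have : s^-1 <= 1 by rewrite invf_le1.
    by lra.
  have bt : b * t <= 1.
    rewrite -[leRHS](mulVf (lt0r_neq0 s0)).
    by rewrite (le_trans (ler_wpM2l _ t2)) ?ler_wpM2r//; lra.
  apply: le_trans (HC r Q t b b1 bt).
  have hQ := half_interval_ln (Q : R) v0 hb.
  rewrite lnV ?posrE// in hQ.
  have lns : 0 <= ln s by rewrite ln_ge0.
  have : Q * ln s <= `|Q| * ln s by rewrite ler_wpM2r// ler_norm.
  have hr : - `|r| <= r * (t - s).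
    have : `|r * (t - s)| <= `|r|.
      by rewrite normrM ler_piMr// ler_norml; lra.
    by rewrite ler_norml => /andP[].
  have : 0 <= m * b * t by rewrite !mulr_ge0//; lra.
  rewrite /K; lra.
Qed.

(** For beta <= v with v small, r + m beta <= - (1 + e) for some e > 0; the box
    eta in ]exp (- s - 1), exp (- s)] then contributes about exp (e s). *)
Lemma kernel_integral_pinfty_lt (r Q : R) : r < -1 ->
  param_integral (posterior_kernel r Q) = +oo%E.
Proof.
move=> r1; apply: param_integral_pinfty.
- exact: measurable_posterior_kernel.
- by move=> z _; exact: kernel_ge0.
move=> A.
have [C HC] := log_kernel_ge l m p.
have m0 : 0 <= m := m_ge0.
(* Half of the distance from r to -1 is left for the term m beta, which v
   is chosen to fit: m v <= e. *)
have [e e0 eE] : exists2 e : R, 0 < e & e = - (r + 1) / 2.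
  by exists (- (r + 1) / 2) => //; lra.
pose v : R := e / (m + 1 + e).
have me0 : 0 < m + 1 + e by lra.
have v0 : 0 < v by rewrite divr_gt0.
have v1 : v <= 1 by rewrite ler_pdivrMr//; lra.
have mv : m * v <= e by rewrite mulrCA ger_pMr// ler_pdivrMr//; lra.
pose C3 : R := `|Q| * ln 2 - Q * ln v + C.
pose s : R := Num.max 0 ((2 * A / v + C3) / e).
have s0 : 0 <= s by rewrite /s le_max lexx.
have sA : 2 * A / v + C3 <= e * s.
  by rewrite [leRHS]mulrC -ler_pdivrMr// /s le_max lexx orbT.
pose K : R := (1 + e) * s - C3.
exists K, (- s), 1, (v / 2), v; split.
- by rewrite ltr01 /=.
- by lra.
- have -> : expR (K - s) * 1 * (v - v / 2) = expR (K - s) * (v / 2) by lra.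
  rewrite -ler_pdivrMr ?divr_gt0//; apply: le_trans (expR_ge1Dx _).
  have -> : A / (v / 2) = 2 * A / v by rewrite invf_div; ring.
  rewrite /K; lra.
- move=> t b /andP[t1 t2] hb; rewrite /posterior_kernel expRK ler_expR.
  have b1 : 0 < b <= 1 by lra.
  have bt : b * t <= 1 by nra.
  apply: le_trans (HC r Q t b b1 bt).
  have hQ := half_interval_ln (Q : R) v0 hb.
  have hm : r + m * b <= - (1 + e).
    have : m * b <= m * v by rewrite ler_wpM2l//; lra.
    by move: mv; rewrite eE; lra.
  have : (1 + e) * s <= (r + m * b) * t by nra.
  rewrite /K /C3; lra.
Qed.

(** On the i-th box, beta <= 1 / (i + 1) keeps eta^beta away from 0, and the
    factor 1 / eta compensates the eta-length. When Q = 0 the divergence is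
    only logarithmic, which is why the harmonic series is needed. *)
Lemma kernel_integral_pinfty_le0 (Q : R) : Q <= 0 ->
  param_integral (posterior_kernel (-1) Q) = +oo%E.
Proof.
move=> Q0.
have [C HC] := log_kernel_ge l m p.
have m0 : 0 <= m := m_ge0.
apply: (@param_integral_pinfty_harmonic _ _ (- m - C)).
- exact: measurable_posterior_kernel.
- by move=> z _; exact: kernel_ge0.
move=> i t b /andP[t1 t2] /andP[b0 bi].
rewrite /posterior_kernel expRK ler_expR.
have i0 : (0 : R) <= i%:R by rewrite ler0n.
have bi1 : b * (i%:R + 1) <= 1 by rewrite natr1 -ler_pdivlMr// mul1r.
have b1 : 0 < b <= 1 by rewrite b0/=; nra.
have bt : b * t <= 1 by nra.
apply: le_trans (HC (-1) Q t b b1 bt).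
have : 0 <= Q * ln b by rewrite mulr_le0// ln_le0//; case/andP: b1.
have : -1 <= b * t by nra.
nra.
Qed.

(** For beta about exp s, the values eta in ]exp (- L - exp (- s)), exp (- L)]
    keep the largest (x_i eta)^beta between two positive constants. This box
    has an area of order 1 and the kernel is of order beta^Q there. *)
Lemma kernel_integral_pinfty_tied (L Q : R) :
  (forall i, l i <= L) -> p = m * L ->
  0 < Q -> param_integral (posterior_kernel (-1) Q) = +oo%E.
Proof.
move=> lL pE Q0; have m0 : 0 <= m := m_ge0; apply: param_integral_pinfty.
- exact: measurable_posterior_kernel.
- by move=> z _; exact: kernel_ge0.
move=> A.
pose s : R := Num.max 0 ((A + 2 * m + n%:R) / Q).
have s0 : 0 <= s by rewrite /s le_max lexx.
have sA : A + 2 * m + n%:R <= Q * s.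
  by rewrite [leRHS]mulrC -ler_pdivrMr// /s le_max lexx orbT.
have v1 : 1 <= expR s by rewrite -expR0 ler_expR.
have v0 := expR_gt0 s.
pose K : R := L - 2 * m + Q * s - n%:R.
exists K, (- L), (expR s)^-1, (expR s), (2 * expR s); split.
- by rewrite invr_gt0 v0 invf_le1.
- by lra.
- have -> : 2 * expR s - expR s = expR s by ring.
  rewrite -mulrA mulVf ?gt_eqF// mulr1; apply: le_trans (expR_ge1Dx _).
  rewrite /K; lra.
- move=> t b /andP[t1 t2] /andP[b1 b2].
  rewrite /posterior_kernel expRK ler_expR.
  have b0 : 0 < b by lra.
  have hb : -2 <= b * (L + t) <= 0.
    apply/andP; split; last by nra.
    have h : - (L + t) <= (expR s)^-1 by lra.
    have : b * - (L + t) <= 2 * expR s * (expR s)^-1 by rewrite ler_pM//; lra.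
    by rewrite mulfK ?gt_eqF//; lra.
  apply: le_trans (log_kernel_ge_tied m_ge0 Q lL pE b0 hb).
  have : Q * s <= Q * ln b.
    by rewrite ler_wpM2l ?(ltW Q0)// -[s]expRK ler_ln ?posrE// ltW.
  rewrite /K; lra.
Qed.

(** The two factors of the bound of [log_kernel_le] are compared with the Cauchy
    densities through min (1, u^(-2)) <= 2 / (1 + u^2). *)
Lemma kernel_le_cauchy (L Q : R) : 1 <= m -> (exists j, l j = L) -> p < m * L ->
  exists2 C : R, 0 <= C & forall z, 0 < z.1 -> 1 <= z.2 ->
    posterior_kernel (-1) Q z <= C * cauchy_weight z.
Proof.
move=> m1 hj pL; have [C HC] := log_kernel_le m_ge0 m1 hj pL Q.
exists (expR C * 4); first by rewrite mulr_ge0// expR_ge0.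
move=> [x y] /= x0 y1.
apply: (@le_trans _ _ (expR (C - Num.max 0 (2 * ln x) - 2 * ln y))).
  by rewrite ler_expR; exact: HC.
have y0 : 0 < y by apply: lt_le_trans y1.
have sqE (u : R) : 0 < u -> expR (- (2 * ln u)) = (u ^+ 2)^-1.
  by move=> u0; rewrite expRN mulrC expRM_natr lnK ?posrE.
have hx : expR (- Num.max 0 (2 * ln x)) <= 2 / oneDsqr x.
  rewrite ler_pdivlMr; last by rewrite /oneDsqr; have := sqr_ge0 x; lra.
  have [lx|lx] := leP 0 (2 * ln x).
    rewrite sqE// mulrC ler_pdivrMr ?exprn_gt0// /oneDsqr.
    have : 1 <= x by rewrite -ler_ln ?posrE// ln1; lra.
    nra.
  rewrite oppr0 expR0 mul1r /oneDsqr.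
  have : x <= 1 by rewrite -ler_ln ?posrE// ln1; lra.
  nra.
have hy : expR (- (2 * ln y)) <= 2 / oneDsqr y.
  rewrite ler_pdivlMr; last by rewrite /oneDsqr; have := sqr_ge0 y; lra.
  rewrite sqE// mulrC ler_pdivrMr ?exprn_gt0// /oneDsqr; nra.
rewrite !expRD -!mulrA ler_wpM2l ?expR_ge0// /cauchy_weight/=.
apply: le_trans (ler_pM (expR_ge0 _) (expR_ge0 _) hx hy) _.
by rewrite le_eqVlt; apply/orP; left; apply/eqP; ring.
Qed.

(** For beta <= 1 the extra factor beta^k is at most 1; for beta >= 1 the kernel
    is dominated by an integrable function for any exponent of beta. *)
Lemma kernel_integral_lty_beta (Q k : R) : 0 < k -> 1 <= m ->
  (exists L, (exists j, l j = L) /\ p < m * L) ->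
  (param_integral (posterior_kernel (-1) Q) < +oo)%E ->
  (param_integral (posterior_kernel (-1) (Q + k)) < +oo)%E.
Proof.
move=> k0 m1 [L [hj pL]] fin.
have [C C0 HC] := kernel_le_cauchy (Q + k) m1 hj pL.
have mw : measurable_fun D (@cauchy_weight R).
  exact: measurable_funS (@measurable_cauchy_weight R).
have mCw : measurable_fun D (fun z => C * @cauchy_weight R z).
  exact: measurable_funM.
have w0 (z : R * R) : 0 <= C * cauchy_weight z.
  by rewrite mulr_ge0// cauchy_weight_ge0.
have mk Q' := measurable_posterior_kernel (-1) Q'.
apply: (@le_lt_trans _ _
   (param_integral (fun z => posterior_kernel (-1) Q z + C * cauchy_weight z))).
  apply: param_integral_le => //; first exact: measurable_funD.
  move=> z /param_spaceP[x0 y0]; rewrite kernel_ge0/=.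
  have [y1|y1] := leP 1 z.2.
    by rewrite (le_trans (HC z x0 y1))// lerDr kernel_ge0.
  apply: (@le_trans _ _ (posterior_kernel (-1) Q z)); last by rewrite lerDl.
  rewrite ler_expR /log_kernel !lerD2r lerD2l.
  by rewrite mulrDl gerDl mulr_ge0_le0 ?(ltW k0)// ln_le0// ltW.
have kp : forall u, D u -> 0 <= posterior_kernel (-1) Q u.
  by move=> u _; exact: kernel_ge0.
have wp : forall u, D u -> 0 <= @cauchy_weight R u.
  by move=> u _; exact: cauchy_weight_ge0.
rewrite [ltLHS](_ : _ = (param_integral (posterior_kernel (-1) Q) +
    C%:E * param_integral (@cauchy_weight R))%E); last first.
  rewrite -(param_integralZ C0 mw wp).
  exact: (param_integralD (mk Q) kp mCw (fun u _ => w0 u)).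
by rewrite lte_add_pinfty// lte_mul_pinfty// cauchy_weight_integral.
Qed.

End Kernel.

(** * Weibull data *)

Section Weibull.
Context {R : realType}.
Local Notation D := (@param_space R).
Variables (n : nat) (x : 'I_n -> R) (delta : 'I_n -> bool).
Hypothesis x_gt0 : forall i, 0 < x i.

Let l i := ln (x i).
Let m : R := (\sum_(i < n) delta i)%N%:R.
Let p : R := \sum_(i < n) (delta i)%:R * l i.

Lemma weibull_kernelE (r q : R) z : D z ->
  z.1 `^ r * z.2 `^ q * weibull_likelihood x delta z =
  posterior_kernel l m p r (q + m) z.
Proof.
case: z => u b /param_spaceP[/= u0 b0].
have pE : \prod_(i < n) x i `^ ((delta i)%:R * b) = expR (p * b).
  under eq_bigr do rewrite powR_expR_ln//.
  rewrite -expR_sum; congr expR; rewrite /p mulr_suml; apply: eq_bigr => i _.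
  by rewrite mulrAC.
have sE : \sum_(i < n) x i `^ b * u `^ b = \sum_(i < n) expR (b * (l i + ln u)).
  apply: eq_bigr => i _; rewrite !powR_expR_ln// -expRD; congr expR.
  by rewrite mulrDr.
rewrite /weibull_likelihood pE sE -powR_mulrn ?(ltW b0)// -/m !powR_expR_ln//.
rewrite /posterior_kernel /log_kernel/= -!expRD; congr expR; ring.
Qed.

Lemma weibull_likelihood_gt0 z : D z -> 0 < weibull_likelihood x delta z.
Proof.
move=> Dz; have := weibull_kernelE 0 0 Dz.
by rewrite !powRr0 !mul1r => ->; exact: expR_gt0.
Qed.

Lemma measurable_weibull_likelihood :
  measurable_fun D (weibull_likelihood x delta).
Proof.
apply: (eq_measurable_fun (posterior_kernel l m p 0 (0 + m)));
  last exact: measurable_posterior_kernel.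
move=> z; rewrite inE => /(weibull_kernelE 0 0) <-.
by rewrite !powRr0 !mul1r.
Qed.

(** p is a sum of m log-times, each of them at most the largest one, so that
    p <= m L. Strictness requires a non-censored observation, since otherwise
    m = p = 0. *)
Lemma maximal_time_dichotomy : (0 < n)%N ->
  exists L, [/\ exists j, l j = L, forall i, l i <= L &
    p = m * L \/ 1 <= m /\ p < m * L].
Proof.
move=> n0; pose i0 := Ordinal n0.
pose j := [arg max_(i > i0) l i]%O.
have lj i : l i <= l j.
  by rewrite /j; case: Order.TotalTheory.arg_maxP => // k _; exact.
exists (l j); split=> //; first by exists j.
have mE : m * l j = \sum_(i < n) (delta i)%:R * l j.
  by rewrite /m natr_sum mulr_suml.
have : p <= m * l j by rewrite mE; apply: ler_sum => i _; rewrite ler_wpM2l.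
rewrite le_eqVlt => /predU1P[|pm]; [by left|right; split=> //].
rewrite /m ler1n lt0n sum_nat_eq0; apply: contraTN pm => /forallP d0.
have dE i : delta i = false by have := d0 i; rewrite implyTb eqb0 => /negbTE.
rewrite mE /p -leNgt le_eqVlt; apply/orP; left; apply/eqP.
by apply: eq_bigr => i _; rewrite dE !mul0r.
Qed.

Let m_ge0 : 0 <= m. Proof. exact: ler0n. Qed.

(** Any other value of r, and also r = -1 with p = m L, would make the integral
    infinite, so that only the exponentially decaying case remains. *)
Lemma finite_kernel_integral_beta (r q k : R) : (0 < n)%N -> 0 < k ->
  (param_integral (posterior_kernel l m p r q) < +oo)%E ->
  r = -1 /\ (param_integral (posterior_kernel l m p r (q + k)) < +oo)%E.
Proof.
move=> n0 k0 fin.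
have [rlt|rgt|rE] := ltgtP r (-1); last 2 first.
- by move: fin; rewrite kernel_integral_pinfty_gt// ltxx.
- split=> //; move: fin; rewrite rE => fin.
  have [L [hj lL [pE|[m1 pL]]]] := maximal_time_dichotomy n0.
    have [q0|q0] := leP q 0.
      by move: fin; rewrite kernel_integral_pinfty_le0// ltxx.
    by move: fin; rewrite (kernel_integral_pinfty_tied m_ge0 lL pE q0) ltxx.
  by apply: kernel_integral_lty_beta => //; exists L.
by move: fin; rewrite kernel_integral_pinfty_lt// ltxx.
Qed.

End Weibull.

Theorem corollary2p2 (R : realType) (q r : R) (prior : R * R -> R)
    (n : nat) (x : 'I_n -> R) (delta : 'I_n -> bool)
    (hn : (1 <= n)%N) (hx : forall i, 0 < x i)
    (himproper : improper_prior prior)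
    (hprior : propto (@param_space R) prior (fun p => p.1 `^ r * p.2 `^ q))
    (hproper : proper_posterior prior x delta) :
  forall k : R, 0 < k ->
    (posterior_expectation prior x delta (fun p => (p.2 `^ k)%R) < +oo)%E /\
    posterior_expectation prior x delta (fun p => p.1 `^ k) = +oo%E.
Proof.
move=> k k0.
have [[mprior _] _] := himproper.
have [c0 [c1 [c00 c10 hc]]] := hprior.
set l := fun i => ln (x i).
set m : R := (\sum_(i < n) delta i)%N%:R.
set p : R := \sum_(i < n) (delta i)%:R * l i.
have m0 : 0 <= m by exact: ler0n.
set Q := q + m.
pose I r' Q' := param_integral (posterior_kernel l m p r' Q').
have mk r' Q' : measurable_fun (@param_space R) (posterior_kernel l m p r' Q').
  exact: measurable_posterior_kernel.
have mck c r' Q' :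
    measurable_fun (@param_space R)
      (fun z => c * posterior_kernel l m p r' Q' z).
  by apply: measurable_funM => //; exact: mk.
have kp r' Q' z : param_space z -> 0 <= posterior_kernel l m p r' Q' z.
  by move=> _; exact: kernel_ge0.
set L := weibull_likelihood x delta.
have mL : measurable_fun (@param_space R) L.
  exact: measurable_weibull_likelihood.
have bnd z : param_space z -> c0 * posterior_kernel l m p r Q z <= prior z * L z
    <= c1 * posterior_kernel l m p r Q z.
  move=> Dz; have /andP[h0 h1] := hc z Dz.
  rewrite -(weibull_kernelE delta hx r q Dz) !mulrA.
  have L0 := ltW (weibull_likelihood_gt0 delta hx Dz).
  rewrite -!(mulrA c0) -!(mulrA c1) in h0 h1 *.
  by apply/andP; split; rewrite mulrA ler_wpM2r.
have mpL : measurable_fun (@param_space R) (fun z => prior z * L z).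
  exact: measurable_funM.
have lowm : (c0%:E * I r Q <= marginal prior x delta)%E.
  rewrite -param_integralZ//; [|exact: ltW|exact: kp].
  apply: param_integral_le => // z Dz.
  by have /andP[-> _] := bnd z Dz; rewrite mulr_ge0 ?(ltW c00) ?kernel_ge0.
have Ifin : (I r Q < +oo)%E.
  have := le_lt_trans lowm hproper.
  rewrite ltey; apply: contraTT; rewrite ltey negbK => /eqP ->.
  by rewrite gt0_muley ?lte_fin.
have [rE Ibeta] := finite_kernel_integral_beta hn k0 Ifin.
have I0 : (0 < I r Q)%E by exact: kernel_integral_gt0.
(* If the normalizing constant were 0, so would be the posterior density, since
   the inverse of 0 is 0; hence the need for the strict inequality. *)
set d := fine (marginal prior x delta).
have d0 : 0 < d.
  rewrite fine_gt0// hproper andbT; apply: lt_le_trans lowm.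
  by rewrite mule_gt0.
have mpost : measurable_fun (@param_space R) (posterior_density prior x delta).
  apply: measurable_funM => //; exact: measurable_funM.
have postE z : posterior_density prior x delta z = d^-1 * (prior z * L z).
  by rewrite /posterior_density -/d -/L mulrAC mulrC.
split.
- apply: (@le_lt_trans _ _ (param_integral (fun z =>
      (d^-1 * c1) * posterior_kernel l m p r (Q + k) z))).
    apply: param_integral_le.
    + apply: measurable_funM => //.
      apply: (@measurable_funS _ _ _ _ setT) => //.
      exact: (measurableT_comp (@measurable_powR R k) measurable_snd).
    + exact: mck.
    + move=> z Dz; have /andP[lo hi] := bnd z Dz.
      have s0 : 0 <= prior z * L z.
        by apply: le_trans lo; rewrite mulr_ge0 ?(ltW c00) ?kernel_ge0.
      have di0 : 0 <= d^-1 by rewrite invr_ge0 ltW.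
      rewrite postE mulr_ge0 ?powR_ge0 ?(mulr_ge0 di0 s0)//=.
      rewrite -(kernel_mul_beta l m p r Q k Dz) mulrCA -!mulrA.
      rewrite ler_wpM2l ?invr_ge0 ?(ltW d0)// [leRHS]mulrCA.
      by rewrite ler_wpM2l ?powR_ge0.
  have dc0 : 0 <= d^-1 * c1 by rewrite mulr_ge0 ?invr_ge0 ?(ltW d0) ?(ltW c10).
  rewrite [ltLHS](_ : _ = (d^-1 * c1)%:E * I r (Q + k)%R)%E; last first.
    exact: param_integralZ dc0 (mk _ _) (kp _ _).
  exact: lte_mul_pinfty.
- apply/eqP; rewrite -leye_eq.
  have -> : (+oo = (d^-1 * c0)%:E * I (r + k)%R Q)%E.
    rewrite /I kernel_integral_pinfty_gt//; last by rewrite rE ltrDl.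
    by rewrite gt0_muley// lte_fin mulr_gt0 ?invr_gt0.
  have dc0 : 0 <= d^-1 * c0 by rewrite mulr_ge0 ?invr_ge0 ?(ltW d0) ?(ltW c00).
  rewrite -param_integralZ//; last exact: kp.
  apply: param_integral_le.
  + exact: mck.
  + apply: measurable_funM => //.
    apply: (@measurable_funS _ _ _ _ setT) => //.
    exact: (measurableT_comp (@measurable_powR R k) measurable_fst).
  + move=> z Dz; have /andP[lo hi] := bnd z Dz.
    rewrite mulr_ge0 ?kernel_ge0 ?mulr_ge0 ?invr_ge0 ?(ltW d0) ?(ltW c00)//=.
    rewrite postE -(kernel_mul_eta l m p r Q k Dz) [leRHS]mulrCA -!mulrA.
    rewrite ler_wpM2l ?invr_ge0 ?(ltW d0)// mulrCA.
    by rewrite ler_wpM2l ?powR_ge0.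
Qed.
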